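(* Let $R$ be a discrete valuation ring with field of fractions $K$, uniformizer $\pi$ and residue field $k=R/\pi R$. Let $V$ be a finite-dimensional $K$-vector space, $G$ a group and $\rho:G\to \mathrm{GL}(V)$ a homomorphism, and assume there exists a $G$-stable lattice of $V$. Let $V_k$ denote the reduction mod $\pi$ of $V$ (defined in the context). Assume that there exists a nondegenerate $G$-invariant $K$-bilinear form on $V$ which is symmetric (resp. alternating); in the symmetric case assume moreover that $\mathrm{char}(k)\neq 2$. Then there exists a nondegenerate $G$-invariant $k$-bilinear form on $V_k$ which is symmetric (resp. alternating).
   Context: A lattice of $V$ is a free $R$-submodule $L\subset V$ such that the natural map $K\otimes_R L\to V$ is an isomorphism. For a $G$-stable lattice $L$, $L/\pi L$ is a finite-dimensional $k[G]$-module; its semisimplification (direct sum of the successive quotients of a Jordan–Hölder filtration) is, up to isomorphism, independent of the choice of the $G$-stable lattice $L$ (Brauer–Nesbitt). This semisimple $k[G]$-module is denoted $V_k$ and called the reduction mod $\pi$ of $V$. A bilinear form $b$ is $G$-invariant if $b(gx,gy)=b(x,y)$ for all $g\in G$. *)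

(* Defs.v *)
From HB Require Import structures.
From mathcomp Require Import all_boot all_order all_algebra.
Set Implicit Arguments. Unset Strict Implicit. Unset Printing Implicit Defensive.
Import GRing.Theory Num.Theory.
Local Open Scope ring_scope.

(* Discrete valuation rings, presented as a subring R of their field of      *)
(* fractions K, with uniformizer pi, and the residue field k = R / pi R,     *)
(* presented as a field k with a surjective ring morphism red : R -> k whose *)
(* kernel is pi R (red is given as a total function K -> k, only its values  *)
(* on R matter).                                                             *)

(* R (a subring of the field K) is a DVR with fraction field K and           *)
(* uniformizer pi: pi is a nonzero non-unit of R and every nonzero element   *)
(* of K is u * pi^m with u a unit of R and m an integer (v(u pi^m) = m is    *)
(* the discrete valuation, and R = {x | v x >= 0}).                          *)
Definition is_DVR_with_uniformizer (K : fieldType) (R : {pred K}) (pi : K) :=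
  [/\ subring_closed R,
      pi \in R, pi != 0, pi^-1 \notin R &
      forall x : K, x != 0 ->
        exists u : K, exists m : int,
          [/\ u \in R, u^-1 \in R & x = u * pi ^ m]].

Definition is_residue_map (K : fieldType) (R : {pred K}) (pi : K)
    (k : fieldType) (red : K -> k) :=
  [/\ red 1 = 1,
      {in R &, forall x y, red (x + y) = red x + red y},
      {in R &, forall x y, red (x * y) = red x * red y},
      (forall a : k, exists2 x, x \in R & red x = a) &
      {in R, forall x, red x = 0 <-> exists2 y, y \in R & x = pi * y}].

(* Representations.  V = K^n as column vectors 'cV[K]_n; rho g acts by       *)
(* v |-> rho g *m v, so rho is a homomorphism iff rho (g h) = rho g *m rho h.*)
Definition is_rep (G : groupType) (F : fieldType) n (rho : G -> 'M[F]_n) :=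
  (forall g, rho g \in unitmx) /\
  (forall g h : G, rho (g * h)%g = rho g *m rho h).

(* A lattice of V = K^n is the R-span of the columns of an invertible        *)
(* matrix B (a free R-submodule L with K (x)_R L ~ V); it is G-stable iff    *)
(* every B^-1 rho(g) B has entries in R.                                     *)
Definition is_lattice_basis (K : fieldType) n (B : 'M[K]_n) := B \in unitmx.

Definition lattice_stable (G : groupType) (K : fieldType) (R : {pred K}) n
    (rho : G -> 'M[K]_n) (B : 'M[K]_n) :=
  forall g i j, (invmx B *m rho g *m B) i j \in R.

(* The k[G]-module L / pi L, in the basis given by the reduction of the      *)
(* columns of B.                                                             *)
Definition reduced_rep (G : groupType) (K k : fieldType) (red : K -> k) n
    (rho : G -> 'M[K]_n) (B : 'M[K]_n) : G -> 'M[k]_n :=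
  fun g => map_mx red (invmx B *m rho g *m B).

(* A subspace of k^n (column vectors) is encoded by a matrix U whose rows    *)
(* are the transposes of spanning vectors; U is stable under the column      *)
(* action of A iff stablemx U A^T.                                           *)
(* A Jordan-Holder filtration of (k^n, S) is given by a change of basis P    *)
(* (columns = new basis) and a labelling blk of the new basis vectors by     *)
(* "levels": W_b = span {P e_j | blk j <= b} is a G-stable filtration, i.e.  *)
(* M_g := P^-1 S(g) P satisfies M_g i j = 0 when blk i > blk j, and every    *)
(* successive quotient W_b / W_{<b} (the diagonal block of level b, for each *)
(* level b that occurs) is simple.  The semisimplification is then the       *)
(* direct sum of these quotients, i.e. k^n with the block-diagonal part of   *)
(* M_g.                                                                      *)
Definition col_stable (F : fieldType) n (U A : 'M[F]_n) := stablemx U A^T.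

Definition block_diag_part (F : fieldType) n (blk : 'I_n -> nat) (M : 'M[F]_n)
  : 'M[F]_n := \matrix_(i, j) (if blk i == blk j then M i j else 0).

Definition level_space {F : fieldType} n (blk : 'I_n -> nat) (b : nat)
  : 'M[F]_n := diag_mx (\row_j (blk j == b)%:R).

Definition is_JH_filtration (G : groupType) (F : fieldType) n
    (S : G -> 'M[F]_n) (P : 'M[F]_n) (blk : 'I_n -> nat) :=
  [/\ P \in unitmx,
      (forall g i j, (blk j < blk i)%N -> (invmx P *m S g *m P) i j = 0) &
      (forall b, (exists i, blk i = b) ->
         forall U : 'M[F]_n, (U <= level_space blk b)%MS ->
           (forall g, col_stable U
                        (block_diag_part blk (invmx P *m S g *m P))) ->
           (U <= (0 : 'M[F]_n))%MS \/ (level_space blk b <= U)%MS)].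

Definition semisimplification (G : groupType) (F : fieldType) n
    (S : G -> 'M[F]_n) (P : 'M[F]_n) (blk : 'I_n -> nat) : G -> 'M[F]_n :=
  fun g => block_diag_part blk (invmx P *m S g *m P).

Definition bform (F : fieldType) n (A : 'M[F]_n) (x y : 'cV[F]_n) : F :=
  (x^T *m A *m y) 0 0.

Definition bform_nondegenerate (F : fieldType) n (A : 'M[F]_n) :=
  forall x : 'cV[F]_n, (forall y, bform A x y = 0) -> x = 0.

Definition bform_invariant (G : groupType) (F : fieldType) n
    (S : G -> 'M[F]_n) (A : 'M[F]_n) :=
  forall g x y, bform A (S g *m x) (S g *m y) = bform A x y.

Definition bform_symmetric (F : fieldType) n (A : 'M[F]_n) :=
  forall x y, bform A x y = bform A y x.

Definition bform_alternating (F : fieldType) n (A : 'M[F]_n) :=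
  forall x, bform A x x = 0.

Definition bform_sym_or_alt (sym : bool) (F : fieldType) n (A : 'M[F]_n) :=
  if sym then bform_symmetric A else bform_alternating A.

(* Main.v *)
(* After adjoining an N-th root of pi, with N larger than every block label,   *)
(* conjugating by diag (pi^(blk i / N)) gives a stable lattice whose reduction *)
(* is the semisimplification W itself: entries strictly above the blocks      *)
(* acquire positive valuation.  Choose a basis of this lattice in which the   *)
(* Gram matrix is C * diag (pi^(e_j / N)) with C invertible modulo the        *)
(* maximal ideal.  Its Jantzen filtration (by the e_j) is stable under W, and *)
(* the rescaled form on each graded piece is invariant, nondegenerate and     *)
(* symmetric (resp. alternating).  Simplicity of the blocks makes e constant  *)
(* on each of them, so the filtration splits W and the forms on the graded    *)
(* pieces add up to a form on W.                                              *)
Require Import Defs.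
From HB Require Import structures.
From mathcomp Require Import all_boot all_order all_algebra.
From mathcomp Require Import perm zify.
Import Order.TTheory GRing.Theory Num.Theory.
Local Open Scope ring_scope.
Set Implicit Arguments. Unset Strict Implicit. Unset Printing Implicit Defensive.

(** Let L be the rescaled lattice over the ramified extension and L# its dual for the form. The form
    pairs L perfectly with L#, so reduction gives a perfect invariant pairing between two
    representations, [W'] on L and [V] on L#. [simultaneous_splitting], a form of the elementary
    divisor theorem, provides vectors X_j such that the pi^(b_j/N) X_j are a basis of L and the
    pi^(-a_j/N) X_j a basis of L#. Put e_j = a_j + b_j. Since both lattices are stable, [W'] and [V]
    are triangular for e in opposite directions with equal diagonal blocks; symmetry up to sign
    makes the pairing triangular too. By [simple_levels_label_constant], [W'] is block diagonal for
    e. Hence the diagonal blocks of the pairing give a [W']-invariant form, nondegenerate by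
    [det_label_block] and of the same symmetry type. This is [wmx_form_reduction]; [theoremA]
    identifies its [W] with the semisimplification. *)

Section BilinearForms.
Variables (F : fieldType) (n : nat).
Implicit Types (A B S X : 'M[F]_n).

(** * Gram matrices of invariant forms *)

Lemma bform_delta A i j : bform A (delta_mx i 0) (delta_mx j 0) = A i j.
Proof. by rewrite /bform trmx_delta -mulmxA -rowE mxE -colE mxE. Qed.

Lemma bform_congr A X x y : bform A (X *m x) (X *m y) = bform (X^T *m A *m X) x y.
Proof. by rewrite /bform trmx_mul !mulmxA. Qed.

Lemma bform_unitmx A : bform_nondegenerate A <-> A \in unitmx.
Proof.
split=> [ndA|uA x xA].
  rewrite unitmxE unitfE; apply/det0P=> -[v v0 vA]; case/negP: v0.
  rewrite -[v]trmxK [v^T]ndA ?trmx0 // => y.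
  by rewrite /bform trmxK vA mul0mx mxE.
have xA0 : x^T *m A = 0.
  by apply/rowP=> j; rewrite [RHS]mxE -(xA (delta_mx j 0)) /bform -colE [in RHS]mxE.
by rewrite -[x]trmxK -[x^T](mulmxK uA) xA0 mul0mx trmx0.
Qed.

Lemma bform_invariantP (G : groupType) (S : G -> 'M[F]_n) A :
  bform_invariant S A <-> forall g, (S g)^T *m A *m S g = A.
Proof.
split=> invA g; last by move=> x y; rewrite bform_congr invA.
by apply/matrixP=> i j; rewrite -!bform_delta -bform_congr invA.
Qed.

(** A single sign treats both symmetry types at once. The zero diagonal is recorded separately
    because skew-symmetry does not imply it in characteristic 2. *)
Lemma bform_sym_or_altP sym A :
  bform_sym_or_alt sym A <->
  (forall i j, A j i = (-1) ^+ (~~ sym) * A i j) /\ (~~ sym -> forall i, A i i = 0).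
Proof.
case: sym => /=; split.
- by move=> symA; split=> // i j; rewrite mul1r -!bform_delta symA.
- case=> symA _ x y; have trA : A^T = A.
    by apply/matrixP=> i j; rewrite mxE symA mul1r.
  have <- : (x^T *m A *m y)^T 0 0 = bform A x y by rewrite mxE.
  by rewrite !trmx_mul trmxK trA mulmxA.
- move=> altA; split=> [i j|_ i]; last by rewrite -bform_delta altA.
  have := altA (delta_mx i 0 + delta_mx j 0).
  have addE (u v : 'M[F]_1) : (u + v) 0 0 = u 0 0 + v 0 0 by rewrite mxE.
  rewrite /bform [(_ + _)^T]linearD !(mulmxDl, mulmxDr) !addE.
  rewrite -![(_ *m _ *m _) 0 0]/(bform _ _ _) !altA !bform_delta add0r addr0.
  by move/eqP; rewrite addr_eq0 mulN1r => /eqP ->.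
case=> asymA /(_ isT) diagA x.
(* A = B - B^T also handles characteristic 2. *)
pose B := \matrix_(i, j) if (i < j)%N then A i j else 0.
have -> : A = B - B^T.
  apply/matrixP=> i j; rewrite !mxE; case: ltngtP => [_|_|/val_inj->].
  - by rewrite subr0.
  - by rewrite sub0r asymA mulN1r.
  - by rewrite diagA subr0.
have subE (u v : 'M[F]_1) : (u - v) 0 0 = u 0 0 - v 0 0 by rewrite !mxE.
rewrite /bform mulmxBr mulmxBl subE.
have <- : (x^T *m B *m x)^T 0 0 = (x^T *m B *m x) 0 0 by rewrite mxE.
by rewrite !trmx_mul trmxK mulmxA subrr.
Qed.

Lemma bform_sym_or_alt_congr sym A X :
  bform_sym_or_alt sym A -> bform_sym_or_alt sym (X^T *m A *m X).
Proof.
by case: sym => /= symA; [move=> x y|move=> x]; rewrite -!bform_congr symA.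
Qed.

Definition label_block (e : 'I_n -> int) A : 'M[F]_n :=
  \matrix_(i, j) if e i == e j then A i j else 0.

(** The total change of label along a permutation is 0, so a permutation that does not preserve
    labels lowers one somewhere, and its Leibniz term contains a zero entry. *)
Lemma det_label_block (e : 'I_n -> int) A :
  (forall i j, e j < e i -> A i j = 0) -> \det (label_block e A) = \det A.
Proof.
move=> trigA; apply: eq_bigr => s _; congr (_ * _).
have [/forallP es|] := boolP [forall i, e i == e (s i)].
  by apply: eq_bigr => i _; rewrite mxE es.
rewrite negb_forall => /existsP[i0 /negPf ni0].
rewrite (bigD1 i0) //= mxE ni0 mul0r; apply/esym.
have [i lt_i|le_es] := pickP (fun i => e (s i) < e i).
  by rewrite (bigD1 i) //= trigA // mul0r.
have sum0 : \sum_i (e (s i) - e i) = 0.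
  by rewrite sumrB [X in _ - X](reindex_perm s) subrr.
have := psumr_eq0P _ sum0 => /(_ _ i0 isT) e0; case/eqP: ni0.
apply/eqP; rewrite eq_sym -subr_eq0; apply/eqP/e0 => i _.
by rewrite subr_ge0 leNgt le_es.
Qed.

End BilinearForms.

(** * Filtrations by an integer label and simple levels *)

Section Labels.
Variables (F : fieldType) (n : nat).

Definition label_upper (e : 'I_n -> int) (A : 'M[F]_n) :=
  forall i j, e j < e i -> A i j = 0.

Lemma label_upperM (e : 'I_n -> int) A B :
  label_upper e A -> label_upper e B -> label_upper e (A *m B).
Proof.
move=> uA uB i j lt_ji; rewrite mxE big1 // => l _.
have [lt_li|le_il] := ltP (e l) (e i); first by rewrite uA // mul0r.
by rewrite uB ?mulr0 // (lt_le_trans lt_ji).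
Qed.

Lemma label_blockM (e : 'I_n -> int) A B :
  label_upper e A -> label_upper e B ->
  label_block e (A *m B) = label_block e A *m label_block e B.
Proof.
move=> uA uB; apply/matrixP=> i j; rewrite !mxE; case: ifPn => [/eqP eij|neij].
  apply: eq_bigr => l _; rewrite !mxE -eij eq_sym.
  case: ltgtP => [lt_l|lt_l|_] //; first by rewrite uA ?mul0r.
  by rewrite uB ?mulr0 // -eij.
apply/esym/big1 => l _; rewrite !mxE.
case: eqP => [eil|]; last by rewrite mul0r.
by rewrite -eil (negPf neij) mulr0.
Qed.

Lemma label_block_tr (e : 'I_n -> int) (A : 'M[F]_n) : label_block e A^T = (label_block e A)^T.
Proof. by apply/matrixP=> i j; rewrite !mxE eq_sym. Qed.

(** Suppose e_i < e_j inside one level. The columns of [C] in that level with label at least e_j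
    span a [W]-stable subspace, because [W'] never lowers labels. It contains column j, so by
    simplicity it is the whole level; but column i of [C] also lies in the level and is independent
    of those columns. *)
Lemma simple_levels_label_constant (I : Type) (W W' : I -> 'M[F]_n)
    (C C' : 'M[F]_n) (blk : 'I_n -> nat) (e : 'I_n -> int) :
  (forall c, (exists i, blk i = c) -> forall U : 'M[F]_n,
     (U <= level_space blk c)%MS -> (forall g, col_stable U (W g)) ->
     (U <= (0 : 'M[F]_n))%MS \/ (level_space blk c <= U)%MS) ->
  C' *m C = 1%:M -> (forall g, W g *m C = C *m W' g) ->
  (forall i j, C i j != 0 -> blk i = blk j) ->
  (forall g i j, W' g i j != 0 -> blk i = blk j /\ e j <= e i) ->
  forall i j, blk i = blk j -> e i = e j.
Proof.
move=> simpleW CC WC Cblk W'blk.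
suff nlt i j : blk i = blk j -> ~ e i < e j.
  by move=> i j bij; case: (ltgtP (e i) (e j)) => [/nlt[]|/nlt[]|].
move=> bij lt_ij.
pose ind l := (blk l == blk i) && (e j <= e l).
pose D : 'M[F]_n := diag_mx (\row_l (ind l)%:R).
have DE x y : D x y = (ind x && (x == y))%:R.
  by rewrite !mxE; case: eqVneq => [->|_]; rewrite ?andbT ?andbF.
have DM (A : 'M[F]_n) x y : (D *m A) x y = (ind x)%:R * A x y.
  by rewrite mul_diag_mx !mxE.
have MD (A : 'M[F]_n) x y : (A *m D) x y = A x y * (ind y)%:R.
  by rewrite mul_mx_diag !mxE.
have levelE (A : 'M[F]_n) x y :
    (A *m level_space blk (blk i)) x y = A x y * (blk y == blk i)%:R.
  by rewrite mul_mx_diag !mxE.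
have trCC : C^T *m C'^T = 1%:M by rewrite -trmx_mul CC trmx1.
case: (simpleW (blk i) _ (D *m C^T)).
- by exists i.
- apply/submxP; exists (D *m C^T); apply/matrixP=> x y; rewrite levelE DM mxE.
  have [->|/Cblk->] := eqVneq (C y x) 0; first by rewrite !(mulr0, mul0r).
  by rewrite /ind; case: eqP; rewrite !(mulr1, mulr0, mul0r).
- move=> g; rewrite /col_stable -mulmxA -trmx_mul WC trmx_mul mulmxA.
  have -> : D *m (W' g)^T = D *m (W' g)^T *m D.
    apply/matrixP=> x y; rewrite MD DM mxE.
    have [->|/W'blk[byx le_xy]] := eqVneq (W' g y x) 0; first by rewrite !(mulr0, mul0r).
    rewrite /ind byx; case: eqP => _; last by rewrite !mul0r.
    by case: (leP (e j) (e x)) => [le_jx|_]; rewrite ?(le_trans le_jx) ?mulr1 ?mul0r.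
  by rewrite -[X in (X <= _)%MS]mulmxA submxMl.
- rewrite submx0 => /eqP DC0.
  have /matrixP/(_ j j) : D = 0 by rewrite -[D]mulmx1 -trCC mulmxA DC0 mul0mx.
  by rewrite DE mxE /ind bij !eqxx lexx /= => /eqP; rewrite oner_eq0.
case/submxP=> Z levZ.
(* Row i of [C'] kills the selected columns of [C], hence the whole level. *)
have C'0 x : blk x = blk i -> C' i x = 0.
  move=> bx; have /matrixP/(_ x i) : level_space blk (blk i) *m C'^T = Z *m D.
    by rewrite levZ -mulmxA -(mulmxA D) trCC mulmx1.
  by rewrite MD mul_diag_mx !mxE bx eqxx mul1r /ind eqxx leNgt lt_ij mulr0.
have /matrixP/(_ i i) := CC; rewrite !mxE eqxx big1 => [/esym/eqP|x _].
  by rewrite oner_eq0.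
have [->|/Cblk/C'0->] := eqVneq (C x i) 0; first by rewrite mulr0.
by rewrite mul0r.
Qed.

End Labels.

(** * The valuation in units of 1/N and reduction of weighted matrices *)

Section WeightedMatrices.
Variables (K : fieldType) (R : {pred K}) (pi : K) (k : fieldType) (red : K -> k).
Hypothesis dvr : is_DVR_with_uniformizer R pi.
Hypothesis resm : is_residue_map R pi red.
Variable N : nat.
Hypothesis N_gt0 : (0 < N)%N.

(* These stand in for the extension by an N-th root of pi, which is never     *)
(* built: [wge m x] says v(x) >= m / N, and [symb m x] is then the leading    *)
(* coefficient of x at level m (0 when N does not divide m).                  *)
Definition wge (m : int) (x : K) :=
  exists2 q : int, m <= N%:Z * q & x * pi ^ (- q) \in R.

Definition symb (m : int) (x : K) : k :=
  if (N %| m)%Z then red (x * pi ^ (- (m %/ N)%Z)) else 0.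

Let R1 : 1 \in R. Proof. by case: dvr => [[]]. Qed.
Let RB : {in R &, forall x y, x - y \in R}. Proof. by case: dvr => [[]]. Qed.
Let RM : {in R &, forall x y, x * y \in R}. Proof. by case: dvr => [[]]. Qed.
Let Rpi : pi \in R. Proof. by case: dvr. Qed.
Let pi0 : pi != 0. Proof. by case: dvr. Qed.
Let R0 : 0 \in R. Proof. by rewrite -(subrr 1) RB. Qed.
Let RN x : x \in R -> - x \in R. Proof. by move=> Rx; rewrite -sub0r RB. Qed.
Let RD x y : x \in R -> y \in R -> x + y \in R.
Proof. by move=> Rx Ry; rewrite -[y]opprK RB ?RN. Qed.
Let RX (q : int) : 0 <= q -> pi ^ q \in R.
Proof.
case: q => // q _; rewrite -exprnP; elim: q => [|q IH]; first by rewrite expr0.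
by rewrite exprS RM.
Qed.
Let piD (p q : int) : pi ^ (p + q) = pi ^ p * pi ^ q.
Proof. exact: expfzDr. Qed.

Let Rdiv_le x (p q : int) : p <= q -> x * pi ^ (- q) \in R -> x * pi ^ (- p) \in R.
Proof.
move=> le_pq Rx.
have -> : - p = - q + (q - p) by lia.
by rewrite piD mulrA RM // RX // subr_ge0.
Qed.

Lemma wge0 m : wge m 0.
Proof.
exists `|m|; last by rewrite mul0r.
nia.
Qed.

Lemma wge_le {m p x} : p <= m -> wge m x -> wge p x.
Proof. by move=> le_pm [q le_mq Rx]; exists q => //; lia. Qed.

Lemma wgeN m x : wge m x -> wge m (- x).
Proof. by case=> q le_mq Rx; exists q; rewrite // mulNr RN. Qed.

Lemma wgeD m x y : wge m x -> wge m y -> wge m (x + y).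
Proof.
case=> p le_mp Rx [q le_mq Ry].
case: (lerP p q) => [le_pq|/ltW le_qp].
  by exists p; rewrite // mulrDl RD // (Rdiv_le le_pq).
by exists q; rewrite // mulrDl RD // (Rdiv_le le_qp).
Qed.

Lemma wgeM m p x y : wge m x -> wge p y -> wge (m + p) (x * y).
Proof.
case=> q le_mq Rx [r le_pr Ry]; exists (q + r); first by lia.
by rewrite opprD piD mulrACA RM.
Qed.

Lemma wge_sum m I (r : seq I) (P : pred I) (f : I -> K) :
  (forall i, P i -> wge m (f i)) -> wge m (\sum_(i <- r | P i) f i).
Proof. by move=> fP; apply: big_ind => //; [exact: wge0 | exact: wgeD]. Qed.

Lemma wge_exhausts x : exists m, wge m x.
Proof.
have [->|x0] := eqVneq x 0; first by exists 0; exact: wge0.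
have [_ _ _ _ /(_ x x0)[u [q [Ru _ ->]]]] := dvr.
exists (N%:Z * q), q => //.
by rewrite -mulrA -piD subrr expr0z mulr1.
Qed.

Lemma wge_separated x : x != 0 -> exists m, ~ wge m x.
Proof.
move=> x0; have [_ _ _ piV /(_ x x0)[u [q [Ru RuV xE]]]] := dvr.
exists (N%:Z * (q + 1)) => -[r le_qr].
have {}le_qr : q + 1 <= r by rewrite -(ler_pM2l (x := N%:Z)).
move=> /(Rdiv_le le_qr).
rewrite xE -mulrA -piD opprD addrA subrr add0r => Rx; move: (RM RuV Rx).
have u0 : u != 0 by apply: contraNneq x0 => u0; rewrite xE u0 mul0r.
by rewrite mulKf // exprN1 (negPf piV).
Qed.

Let red0P : {in R, forall x, red x = 0 <-> exists2 y, y \in R & x = pi * y}.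
Proof. by case: resm. Qed.
Let redD : {in R &, forall x y, red (x + y) = red x + red y}.
Proof. by case: resm. Qed.
Let redM : {in R &, forall x y, red (x * y) = red x * red y}.
Proof. by case: resm. Qed.
Let red0 : red 0 = 0.
Proof. by apply/(red0P R0); exists 0; rewrite ?mulr0. Qed.

Let wgeP m d x : m = N%:Z * d -> wge m x <-> x * pi ^ (- d) \in R.
Proof.
move=> ->; split=> [[q le_dq]|Rx]; last by exists d.
by apply: Rdiv_le; rewrite -(ler_pM2l (x := N%:Z)).
Qed.

Let symbE m d x : m = N%:Z * d -> symb m x = red (x * pi ^ (- d)).
Proof.
by move=> ->; rewrite /symb dvdz_mulr // mulKz //; lia.
Qed.

Let symb_ndvd m x : ~~ (N %| m)%Z -> symb m x = 0.
Proof. by rewrite /symb => /negPf->. Qed.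

Let wge_ndvd m x : ~~ (N %| m)%Z -> wge m x -> wge (m + 1) x.
Proof.
move=> Nm [q le_mq Rx]; exists q => //.
have /eqP neq : m != N%:Z * q by apply: contraNneq Nm => ->; rewrite dvdz_mulr.
lia.
Qed.

Let dvdE m : (N %| m)%Z -> exists d, m = N%:Z * d.
Proof. by move=> /dvdzP[d ->]; exists d; rewrite mulrC. Qed.

(** The graded piece of level m is R / pi R when N divides m, and zero otherwise because the
    valuation on [K] takes integer values. *)
Lemma symb_eq0 m x : wge m x -> symb m x = 0 <-> wge (m + 1) x.
Proof.
move=> xm; have [/dvdE[d mE]|Nm] := boolP (N %| m)%Z; last first.
  by rewrite symb_ndvd //; split=> // _; apply: wge_ndvd.
have Rx := (wgeP x mE).1 xm; rewrite (symbE x mE); split.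
  move=> /(red0P Rx)[y Ry xE]; exists (d + 1); first by lia.
  by rewrite opprD piD mulrA xE exprN1 mulrAC mulfV // mul1r.
case=> q le_q; have le_dq : d + 1 <= q by rewrite mE in le_q; nia.
move=> /(Rdiv_le le_dq) Ry; apply/red0P => //.
exists (x * pi ^ (- (d + 1))) => //.
by rewrite opprD piD exprN1 [pi * _]mulrC -!mulrA mulVf // mulr1.
Qed.

Lemma symbD m x y : wge m x -> wge m y -> symb m (x + y) = symb m x + symb m y.
Proof.
move=> xm ym; have [/dvdE[d mE]|Nm] := boolP (N %| m)%Z; last first.
  by rewrite !symb_ndvd // addr0.
by rewrite !(symbE _ mE) mulrDl redD //; apply/(wgeP _ mE).
Qed.

Lemma symb0 m : symb m 0 = 0.
Proof. by apply/symb_eq0; apply: wge0. Qed.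

Lemma symbN m x : wge m x -> symb m (- x) = - symb m x.
Proof.
move=> xm; apply/eqP; rewrite -addr_eq0 -symbD ?addNr ?symb0 //.
exact: wgeN.
Qed.

Lemma symb_sum m I (r : seq I) (f : I -> K) :
  (forall i, wge m (f i)) ->
  symb m (\sum_(i <- r) f i) = \sum_(i <- r) symb m (f i).
Proof.
move=> fP; elim: r => [|i r IH]; first by rewrite !big_nil symb0.
by rewrite !big_cons symbD ?IH //; apply: wge_sum.
Qed.

Lemma symbM m p x y :
  wge m x -> wge p y -> symb (m + p) (x * y) = symb m x * symb p y.
Proof.
(* If N does not divide the level of one factor, that factor has weight one higher, hence so does
   the product, even when N divides m + p. *)
move=> xm yp; have [Nm|Nm] := boolP (N %| m)%Z; last first.
  rewrite (symb_ndvd x Nm) mul0r; apply/symb_eq0; first exact: wgeM.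
  by rewrite addrAC; apply: wgeM => //; apply: wge_ndvd.
have [Np|Np] := boolP (N %| p)%Z; last first.
  rewrite (symb_ndvd y Np) mulr0; apply/symb_eq0; first exact: wgeM.
  by rewrite -addrA; apply: wgeM => //; apply: wge_ndvd.
have [[d mE] [e pE]] := (dvdE Nm, dvdE Np).
have mpE : m + p = N%:Z * (d + e) by rewrite mE pE mulrDr.
rewrite (symbE _ mE) (symbE _ pE) (symbE _ mpE) opprD piD mulrACA.
by apply: redM; [exact/(wgeP _ mE)|exact/(wgeP _ pE)].
Qed.

Lemma symb_surj m a : (N %| m)%Z -> exists2 x, wge m x & symb m x = a.
Proof.
move=> /dvdE[d mE]; have [_ _ _ /(_ a)[y Ry yE] _] := resm.
have yK : y * pi ^ d * pi ^ (- d) = y by rewrite -mulrA -piD subrr mulr1.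
by exists (y * pi ^ d); rewrite ?(symbE _ mE) ?yK //; apply/(wgeP _ mE); rewrite yK.
Qed.

Lemma symb_supp m x : symb m x != 0 -> (N %| m)%Z.
Proof. by apply: contraR => /symb_ndvd->. Qed.

Lemma wge_ring x : wge 0 x <-> x \in R.
Proof. by rewrite (wgeP (d := 0)) ?mulr0 // oppr0 expr0z mulr1. Qed.

Lemma symb_ring x : symb 0 x = red x.
Proof. by rewrite (symbE (d := 0)) ?mulr0 // oppr0 expr0z mulr1. Qed.

Lemma symb1 : symb 0 1 = 1.
Proof. by rewrite symb_ring; case: resm. Qed.

Lemma wge1 : wge 0 1. Proof. exact/wge_ring. Qed.

Lemma wge_red0 x (m : int) : m <= N -> x \in R -> red x = 0 -> wge m x.
Proof.
move=> le_mN Rx /(red0P Rx)[y Ry ->]; exists 1; first by rewrite mulr1.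
by rewrite exprN1 mulrAC mulfV // mul1r.
Qed.

Lemma wge_sign m (c : bool) x : wge m x -> wge m ((-1) ^+ c * x).
Proof. by case: c => xm; rewrite ?mulN1r ?mul1r //; apply: wgeN. Qed.

Lemma symb_sign m (c : bool) x :
  wge m x -> symb m ((-1) ^+ c * x) = (-1) ^+ c * symb m x.
Proof. by case: c => xm; rewrite ?mulN1r ?mul1r //; apply: symbN. Qed.

Lemma wge_symb_prod I (r : seq I) (m : I -> int) (f : I -> K) :
  (forall i, wge (m i) (f i)) ->
  wge (\sum_(i <- r) m i) (\prod_(i <- r) f i) /\
  symb (\sum_(i <- r) m i) (\prod_(i <- r) f i) = \prod_(i <- r) symb (m i) (f i).
Proof.
move=> fP; elim: r => [|i r [IHw IHs]].
  by rewrite !big_nil symb1; split=> //; apply: wge1.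
rewrite !big_cons symbM // IHs; split=> //; exact: wgeM.
Qed.

Lemma wge_bound (s : seq K) : exists m, forall x, x \in s -> wge m x.
Proof.
elim: s => [|x s [m IH]]; first by exists 0.
have [p xp] := wge_exhausts x; exists (Num.min m p) => y.
rewrite inE => /predU1P[->|/IH ym]; first by apply: wge_le xp; lia.
by apply: wge_le ym; lia.
Qed.

(* [wmx r s A]: the matrix diag (pi^(-r i / N)) A diag (pi^(-s j / N)) is      *)
(* integral over the ramified extension; [smx r s A] is its reduction.        *)
Definition wmx m n (r : 'I_m -> int) (s : 'I_n -> int) (A : 'M[K]_(m, n)) :=
  forall i j, wge (r i + s j) (A i j).

Definition smx m n (r : 'I_m -> int) (s : 'I_n -> int) (A : 'M[K]_(m, n)) :=
  \matrix_(i, j) symb (r i + s j) (A i j).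

Lemma wmx_tr m n (r : 'I_m -> int) (s : 'I_n -> int) A :
  wmx r s A -> wmx s r A^T.
Proof. by move=> wA i j; rewrite mxE addrC. Qed.

Lemma smx_tr m n (r : 'I_m -> int) (s : 'I_n -> int) A :
  smx s r A^T = (smx r s A)^T.
Proof. by apply/matrixP=> i j; rewrite !mxE addrC. Qed.

Section Product.
Variables (m n p : nat) (r : 'I_m -> int) (s s' : 'I_n -> int) (t : 'I_p -> int).
Hypothesis ss' : forall j, s j + s' j = 0.
Variables (A : 'M[K]_(m, n)) (B : 'M[K]_(n, p)).
Hypotheses (wA : wmx r s A) (wB : wmx s' t B).

Let rtE i j l : r i + t j = (r i + s l) + (s' l + t j).
Proof. by have := ss' l; lia. Qed.

Lemma wmxM : wmx r t (A *m B).
Proof. by move=> i j; rewrite mxE; apply: wge_sum => l _; rewrite (rtE _ _ l); apply: wgeM. Qed.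

Lemma smxM : smx r t (A *m B) = smx r s A *m smx s' t B.
Proof.
apply/matrixP=> i j; rewrite !mxE symb_sum => [|l].
  by apply: eq_bigr => l _; rewrite !mxE (rtE _ _ l) symbM.
by rewrite (rtE _ _ l); apply: wgeM.
Qed.
End Product.

Lemma wmx1 n (b : 'I_n -> int) : wmx b (fun i => - b i) 1%:M.
Proof.
move=> i j; rewrite mxE; case: eqVneq => [->|_]; last exact: wge0.
by rewrite subrr; apply: wge1.
Qed.

Lemma smx1 n (b : 'I_n -> int) : smx b (fun i => - b i) 1%:M = 1%:M.
Proof.
apply/matrixP=> i j; rewrite !mxE; case: eqVneq => [->|_]; last exact: symb0.
by rewrite subrr symb1.
Qed.

(** All Leibniz terms have the same total weight, since a permutation only reorders the [s i]. *)
Lemma wmx_det n (r s : 'I_n -> int) (A : 'M[K]_n) : wmx r s A ->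
  wge (\sum_i (r i + s i)) (\det A) /\
  symb (\sum_i (r i + s i)) (\det A) = \det (smx r s A).
Proof.
move=> wA.
have sumE (g : 'S_n) : \sum_i (r i + s i) = \sum_i (r i + s (g i)).
  by rewrite !big_split /= [X in _ + X](reindex_perm g).
have prodP (g : 'S_n) := wge_symb_prod (index_enum 'I_n) (fun i => wA i (g i)).
have wterm (g : 'S_n) :
    wge (\sum_i (r i + s i)) ((-1) ^+ g * \prod_i A i (g i)).
  by rewrite (sumE g); apply: wge_sign; case: (prodP g).
split; first exact: wge_sum.
rewrite symb_sum //; apply: eq_bigr => g _.
rewrite (sumE g) symb_sign; last by case: (prodP g).
by congr (_ * _); case: (prodP g) => _ ->; apply: eq_bigr => i _; rewrite mxE.
Qed.

(** * Cancellation and bases adapted to the form *)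

Lemma wmx_bound m n (r : 'I_m -> int) (s : 'I_n -> int) (A : 'M[K]_(m, n)) :
  exists d : nat, wmx r (fun j => s j - d%:Z) A.
Proof.
have [q qP] := wge_bound (codom (fun ij => A ij.1 ij.2)).
exists (absz q + \sum_i absz (r i) + \sum_j absz (s j))%N => i j.
have /qP Aq : A i j \in codom (fun ij => A ij.1 ij.2).
  by apply/codomP; exists (i, j).
apply: wge_le Aq; rewrite (bigD1 i) //= [in X in (_ + X)%N](bigD1 j) //=.
lia.
Qed.

(** A matrix with invertible reduction is invertible over the valuation ring. Here a denominator
    pi^(d/N) is allowed in [B]; while d > 0, the symbol of [A] kills that of [B], which therefore
    vanishes, and d drops by 1. *)
Lemma wmx_cancel m p (r s s' : 'I_m -> int) (t : 'I_p -> int)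
    (A : 'M[K]_m) (B : 'M[K]_(m, p)) :
  (forall j, s j + s' j = 0) -> wmx r s A -> smx r s A \in unitmx ->
  wmx r t (A *m B) -> wmx s' t B.
Proof.
move=> ss' wA uA wAB; have [d] := wmx_bound s' t B.
elim: d => [|d IH] wB; first by move=> i j; have := wB i j; rewrite subr0.
apply: IH => i j.
have tE : s' i + (t j - d%:Z) = s' i + (t j - d.+1%:Z) + 1 by lia.
rewrite tE; apply/symb_eq0; first exact: wB.
pose td j := t j - d.+1%:Z.
have smx0 : smx r td (A *m B) = 0.
  apply/matrixP=> x y; rewrite mxE [RHS]mxE.
  have wt : wge (r x + td y + 1) ((A *m B) x y).
    by apply: wge_le (wAB x y); rewrite /td; lia.
  by apply/symb_eq0 => //; apply: wge_le wt; lia.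
have := smxM ss' wA wB; rewrite smx0 => /(congr1 (mulmx (invmx (smx r s A)))).
by rewrite mulKmx // mulmx0 => /matrixP/(_ i j); rewrite !mxE.
Qed.

(* The symbol matrix is graded by exponents mod N, so the restriction of a    *)
(* kernel vector to one residue class is again in the kernel; this makes it   *)
(* liftable.                                                                  *)
Lemma singular_graded_kernel n (b a : 'I_n -> int) (Gam : 'M[K]_n) :
  smx (fun i => - b i) a Gam \notin unitmx ->
  exists j0 (c : 'I_n -> k),
    [/\ c j0 = 1,
        forall j, c j != 0 -> (N %| a j0 - a j)%Z /\ a j + b j <= a j0 + b j0 &
        forall i, \sum_j smx (fun i => - b i) a Gam i j * c j = 0].
Proof.
set A := smx _ _ _ => singA.
have [v v0 vA] : exists2 v : 'rV_n, v != 0 & v *m A^T = 0.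
  by apply/det0P; rewrite det_tr -[_ == 0]negbK -unitfE -unitmxE.
have {}vA i : \sum_j A i j * v 0 j = 0.
  transitivity ((v *m A^T) 0 i); last by rewrite vA mxE.
  by rewrite mxE; apply: eq_bigr => j _; rewrite [A^T _ _]mxE mulrC.
have A_supp i j : A i j != 0 -> (N %| - b i + a j)%Z.
  by rewrite mxE => /symb_supp.
have [j1 vj1] := rV0Pn _ v0.
pose C j := (v 0 j != 0) && (N %| a j - a j1)%Z.
have C1 : C j1 by rewrite /C vj1 subrr dvdz0.
(* Maximality of a + b at [j0] gives a_j0 - a_j >= b_j - b_j0, so lifted coefficients are integral
   for the weights [b]. *)
case: (arg_maxP (fun j => a j + b j) C1) => j0 /andP[vj0 Nj0] maxj0.
exists j0, (fun j => if C j then v 0 j / v 0 j0 else 0); split.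
- by rewrite /C vj0 Nj0 divff.
- move=> j; case: ifP => [Cj _|_]; last by rewrite eqxx.
  split; last exact: maxj0.
  case/andP: Cj => _ Nj; have -> : a j0 - a j = (a j0 - a j1) - (a j - a j1) by lia.
  by rewrite rpredB.
move=> i; have [Ni|Ni] := boolP (N %| - b i + a j1)%Z.
  transitivity ((\sum_j A i j * v 0 j) / v 0 j0); last by rewrite vA mul0r.
  rewrite mulr_suml; apply: eq_bigr => j _; case: ifP => [_|/negbT]; first by rewrite mulrA.
  rewrite /C negb_and negbK => /orP[/eqP->|Nj]; first by rewrite !(mulr0, mul0r).
  have [->|/A_supp Nij] := eqVneq (A i j) 0; first by rewrite !mul0r.
  case/negP: Nj; have -> : a j - a j1 = (- b i + a j) - (- b i + a j1) by lia.
  by rewrite rpredB.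
apply: big1 => j _; case: ifP => [/andP[_ Nj]|_]; last by rewrite mulr0.
have [->|/A_supp Nij] := eqVneq (A i j) 0; first by rewrite mul0r.
case/negP: Ni; have -> : - b i + a j1 = (- b i + a j) - (a j - a j1) by lia.
by rewrite rpredB.
Qed.

(** The kernel vector lifts to a column operation [E] adding multiples of other columns to column
    [j0]. [E] and its inverse [F] preserve the lattice of weights [b], and the new column [j0] has
    zero symbol, so its exponent can grow by 1. *)
Lemma splitting_step n (b a : 'I_n -> int) (Gam : 'M[K]_n) :
  wmx (fun i => - b i) a Gam -> smx (fun i => - b i) a Gam \notin unitmx ->
  exists E F j0,
    [/\ E *m F = 1%:M, wmx b (fun i => - b i) E, wmx b (fun i => - b i) F &
        wmx (fun i => - b i) (fun j => a j + (j == j0)%:Z) (Gam *m E)].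
Proof.
move=> wG /singular_graded_kernel[j0 [c [cj0 cP cK]]].
have /fin_all_exists[y yP] j : exists y, [/\ wge (a j0 - a j) y,
    symb (a j0 - a j) y = c j, wge (b j - b j0) y & j = j0 -> y = 1].
  have [->|neq_j] := eqVneq j j0.
    by exists 1; rewrite !subrr cj0 symb1; split=> //; apply: wge1.
  have [->|cj] := eqVneq (c j) 0.
    by exists 0; rewrite symb0; split=> //; [apply: wge0|apply: wge0|move/eqP: neq_j].
  have [Nj lej] := cP j cj; have [z wz <-] := symb_surj (c j) Nj.
  exists z; split=> //; last by move/eqP: neq_j.
  by apply: wge_le wz; lia.
pose z : 'cV[K]_n := \col_i (if i == j0 then 0 else y i).
pose Z : 'M[K]_n := z *m delta_mx 0 j0.
have ZE i j : Z i j = z i 0 * (j == j0)%:R.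
  by rewrite mxE big_ord1 !mxE eqxx.
have wz i : wge (b i - b j0) (z i 0).
  by rewrite mxE; case: ifP => _; [apply: wge0|case: (yP i)].
have wZ : wmx b (fun i => - b i) Z.
  move=> i j; rewrite ZE; case: eqVneq => [->|_]; first by rewrite mulr1.
  by rewrite mulr0; apply: wge0.
have ZZ : Z *m Z = 0.
  have dz : delta_mx 0 j0 *m z = 0 :> 'M_1.
    by apply/matrixP=> i j; rewrite -rowE !mxE eqxx.
  by rewrite /Z mulmxA -(mulmxA z) dz mulmx0 mul0mx.
exists (1%:M + Z), (1%:M - Z), j0; split.
- by rewrite mulmxDl mul1mx mulmxBr mulmx1 ZZ subr0 subrK.
- by move=> i j; rewrite mxE; apply: wgeD; [apply: wmx1|apply: wZ].
- by move=> i j; rewrite mxE [(- Z) i j]mxE; apply: wgeD; [apply: wmx1|apply/wgeN/wZ].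
move=> i j; have -> : (Gam *m (1%:M + Z)) i j = Gam i j + (Gam *m z) i 0 * (j == j0)%:R.
  by rewrite mulmxDr mulmx1 mulmxA mxE; congr (_ + _); rewrite mxE big_ord1 !mxE eqxx.
case: (eqVneq j j0) => [->|_]; last by rewrite mulr0 !addr0; apply: wG.
have -> : Gam i j0 + (Gam *m z) i 0 * 1%:R = \sum_l Gam i l * y l.
  rewrite mulr1 mxE (bigD1 j0) //= [RHS](bigD1 j0) //= mxE eqxx mulr0 add0r.
  have [_ _ _ ->] // := yP j0; rewrite mulr1; congr (_ + _).
  by apply: eq_bigr => l /negPf nl; rewrite mxE nl.
have tE l : - b i + a j0 = (- b i + a l) + (a j0 - a l) by lia.
have wt l : wge (- b i + a j0) (Gam i l * y l).
  by rewrite (tE l); apply: wgeM; [apply: wG|case: (yP l)].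
rewrite addrA; apply/symb_eq0; first exact: wge_sum.
rewrite symb_sum // -[RHS](cK i); apply: eq_bigr => l _.
by rewrite (tE l) symbM ?mxE; [case: (yP l) => _ ->|apply: wG|case: (yP l)].
Qed.

(* Each splitting step raises the sum of the exponents a, which is bounded by *)
(* the valuation of the determinant.                                          *)
Lemma simultaneous_splitting n (b : 'I_n -> int) (Gam : 'M[K]_n) :
  Gam \in unitmx ->
  exists (a : 'I_n -> int) (X Y : 'M[K]_n),
    [/\ X *m Y = 1%:M, wmx b (fun i => - b i) X, wmx b (fun i => - b i) Y,
        wmx (fun i => - b i) a (Gam *m X) &
        smx (fun i => - b i) a (Gam *m X) \in unitmx].
Proof.
move=> uG; have [d wG] := wmx_bound (fun i => - b i) (fun=> 0) Gam.
have [m nm] : exists m, ~ wge m (\det Gam).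
  by apply: wge_separated; rewrite -unitfE -unitmxE.
pose a0 (j : 'I_n) := 0 - d%:Z.
(* [t] bounds how far the sum of the exponents can still rise; each splitting step consumes 1. *)
have [t] : exists t : nat, ~ wge (\sum_i (- b i + a0 i) + t%:Z) (\det Gam).
  exists (absz (m - \sum_i (- b i + a0 i))%R) => w.
  by apply: nm; apply: wge_le w; lia.
have {wG} : wmx (fun i => - b i) a0 Gam by [].
move: a0 => a; move=> {uG d m nm}.
elim: t Gam a => [|t IH] Gam a wG nG.
  by case: nG; rewrite addr0; case: (wmx_det wG).
have [uS|/(splitting_step wG)[E [F [j0 [EF wE wF wGE]]]]] :=
    boolP (smx (fun i => - b i) a Gam \in unitmx).
  exists a, 1%:M, 1%:M; rewrite !mulmx1.
  by split=> //; apply: wmx1.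
have [|a' [X [Y [XY wX wY wGX uGX]]]] := IH _ _ wGE.
  move=> w; apply: nG.
  have [wdF _] := wmx_det wF; rewrite big1 in wdF => [|i _]; last exact: subrr.
  have -> : \det Gam = \det (Gam *m E) * \det F.
    by rewrite -det_mulmx -mulmxA EF mulmx1.
  rewrite -[X in wge X]addr0; apply: wgeM wdF; apply: wge_le w.
  have -> : \sum_i (- b i + (a i + (i == j0)%:Z)) = \sum_i (- b i + a i) + 1.
    rewrite (eq_bigr (fun i => (- b i + a i) + (i == j0)%:Z)) => [|i _]; last by rewrite addrA.
    rewrite big_split /=; congr (_ + _).
    by rewrite (bigD1 j0) //= eqxx big1 ?addr0 // => i /negPf->.
  lia.
have bb j : - b j + b j = 0 by rewrite addNr.
exists a', (E *m X), (Y *m F); split.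
- by rewrite mulmxA -(mulmxA E) XY mulmx1.
- exact (wmxM bb wE wX).
- exact (wmxM bb wY wF).
- by rewrite mulmxA.
- by rewrite mulmxA.
Qed.

(** * Reduction of the form in the adapted basis *)

Lemma symb_label (i j : nat) x :
  (i < N)%N -> (j < N)%N -> symb (i%:Z - j%:Z) x != 0 -> i = j.
Proof.
move=> iN jN /symb_supp/dvdzP[q].
case: (ltrgtP q 0) => [q_lt0|q_gt0|->]; last by lia.
  have : q * N%:Z <= - N%:Z by rewrite -mulN1r ler_pM2r //; lia.
  by lia.
have : N%:Z <= q * N%:Z by rewrite -[leLHS]mul1r ler_pM2r //; lia.
by lia.
Qed.

Lemma wmx_form_reduction (G : Type) n (sym : bool) (blk : 'I_n -> nat)
    (M : G -> 'M[K]_n) (Gam : 'M[K]_n) :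
  let b i := (blk i)%:Z in let W g := smx b (fun i => - b i) (M g) in
  (forall i, blk i < N)%N ->
  (forall g, wmx b (fun i => - b i) (M g)) ->
  (forall g, exists h, M h *m M g = 1%:M) ->
  (forall c, (exists i, blk i = c) -> forall U : 'M[k]_n,
     (U <= level_space blk c)%MS -> (forall g, col_stable U (W g)) ->
     (U <= (0 : 'M[k]_n))%MS \/ (level_space blk c <= U)%MS) ->
  Gam \in unitmx -> (forall g, (M g)^T *m Gam *m M g = Gam) ->
  bform_sym_or_alt sym Gam ->
  exists A : 'M[k]_n, [/\ A \in unitmx, forall g, (W g)^T *m A *m W g = A &
                          bform_sym_or_alt sym A].
Proof.
move=> b W blkN wM MV simpleW uGam invGam symGam.
pose nb i := - b i.
have [a [X [Y [XY wX wY wGX uGX]]]] := simultaneous_splitting b uGam.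
have bnb j : b j + nb j = 0 by rewrite subrr.
have nbb j : nb j + b j = 0 by rewrite addNr.
pose na i := - a i; have ana j : a j + na j = 0 by rewrite subrr.
pose C := smx b nb X; pose C' := smx b nb Y.
have CC : C *m C' = 1%:M by rewrite -(smxM nbb wX wY) XY smx1.
have CC' := mulmx1C CC.
have smx_blk (A : 'M_n) i j : smx b nb A i j != 0 -> blk i = blk j.
  by rewrite mxE => /symb_label->.
pose M' g := Y *m M g *m X.
have wM' g : wmx b nb (M' g) := wmxM nbb (wmxM nbb wY (wM g)) wX.
pose W' g := smx b nb (M' g).
have WC g : W g *m C = C *m W' g.
  rewrite -(smxM nbb (wM g) wX) -(smxM nbb wX (wM' g)).
  by rewrite !mulmxA XY mul1mx.
(* Stability of the dual lattice, which follows from invariance of the form. *)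
have wM'a g : wmx na a (M' g).
  apply: (wmx_cancel ana wGX uGX).
  have [h hg] := MV g.
  have -> : Gam *m X *m M' g = (M h)^T *m (Gam *m X).
    have gh : (M h)^T *m (M g)^T = 1%:M by rewrite -trmx_mul (mulmx1C hg) trmx1.
    rewrite -[in RHS](invGam g) !mulmxA gh mul1mx -(mulmxA Gam) XY mulmx1.
    by [].
  exact (wmxM bnb (wmx_tr (wM h)) wGX).
pose e i := a i + b i.
(* The entry has both weights b_i - b_j and a_j - a_i; the second is the larger one when e_i <
   e_j. *)
have W'upper g i j : e i < e j -> W' g i j = 0.
  move=> lt_ij; rewrite mxE; apply/symb_eq0 => //; first exact: wM'.
  by apply: wge_le (wM'a g i j); rewrite /na /nb; rewrite /e in lt_ij; lia.
have e_const : forall i j, blk i = blk j -> e i = e j.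
  apply: (simple_levels_label_constant simpleW CC' WC) => [i j|g i j W'ij].
    exact: smx_blk.
  split; first exact: smx_blk W'ij.
  by rewrite leNgt; apply: contra W'ij => /W'upper->.
pose Phi := X^T *m (Gam *m X).
have wPhi : wmx nb a Phi := wmxM bnb (wmx_tr wX) wGX.
have uDel : smx nb a Phi \in unitmx.
  rewrite (smxM bnb (wmx_tr wX) wGX) unitmx_mul uGX andbT smx_tr unitmx_tr.
  by case: (mulmx1_unit CC).
have /bform_sym_or_altP[symPhi altPhi] : bform_sym_or_alt sym Phi.
  by rewrite /Phi mulmxA; apply: bform_sym_or_alt_congr.
set Del := smx nb a Phi in uDel.
(* Up to sign Phi_ij is Phi_ji, whose weight a_i - b_j exceeds a_j - b_i when e_j < e_i. *)
have Del_upper : label_upper e Del.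
  move=> i j lt_ji; rewrite mxE; apply/symb_eq0 => //.
  rewrite symPhi; apply: wge_sign; apply: wge_le (wPhi j i).
  by rewrite /nb; rewrite /e in lt_ji; lia.
pose V g := smx na a (M' g).
have V_upper g : label_upper e (V g).
  move=> i j lt_ji; rewrite mxE; apply/symb_eq0 => //; first exact: wM'a.
  apply: wge_le (wM' g i j).
  by rewrite /na /nb; rewrite /e in lt_ji; lia.
(* Invariance of the reduced pairing between the lattice and its dual. *)
have WDV g : (W' g)^T *m (Del *m V g) = Del.
  have wPM : wmx nb a (Phi *m M' g) := wmxM ana wPhi (wM'a g).
  rewrite -(smxM ana wPhi (wM'a g)) -smx_tr -(smxM bnb (wmx_tr (wM' g)) wPM).
  have trXY : Y^T *m X^T = 1%:M by rewrite -trmx_mul XY trmx1.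
  congr smx; rewrite /M' /Phi !trmx_mul !mulmxA -(mulmxA _ Y^T X^T) trXY mulmx1.
  rewrite -(mulmxA _ X Y) XY mulmx1.
  by rewrite -[in RHS](invGam g) !mulmxA.
pose D0 := label_block e Del.
have blockW g : label_block e (W' g) = W' g.
  apply/matrixP=> i j; rewrite [LHS]mxE; case: eqP => // neij.
  by have [->|/smx_blk/e_const/neij] := eqVneq (W' g i j) 0.
(* When e_i = e_j the weights b_i - b_j and a_j - a_i coincide, so both reductions have the same
   entry. *)
have blockV g : label_block e (V g) = W' g.
  rewrite -(blockW g); apply/matrixP=> i j; rewrite [LHS]mxE [RHS]mxE.
  case: eqP => // eij; rewrite mxE [RHS]mxE; congr symb.
  by rewrite /na /nb; rewrite /e in eij; lia.
have invD0 g : (W' g)^T *m D0 *m W' g = D0.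
  have WT_upper : label_upper e (W' g)^T by move=> i j lt_ji; rewrite mxE W'upper.
  rewrite -{2}(blockV g) -mulmxA -(label_blockM Del_upper (V_upper g)).
  rewrite -(blockW g) -label_block_tr -label_blockM ?WDV //.
  exact: label_upperM.
(* Transport back from [W'] to [W] along the intertwiner [C], whose inverse is [C']. *)
exists (C'^T *m D0 *m C'); split.
- have [uC uC'] := mulmx1_unit CC.
  rewrite !unitmx_mul unitmx_tr uC' andbT /=.
  by rewrite unitmxE det_label_block // -unitmxE.
- move=> g; have C'W : C' *m W g = W' g *m C'.
    by rewrite -[LHS]mulmx1 -CC mulmxA -(mulmxA C') WC !mulmxA CC' mul1mx.
  transitivity ((C' *m W g)^T *m D0 *m (C' *m W g)).
    by rewrite trmx_mul !mulmxA.
  by rewrite C'W trmx_mul -[in RHS](invD0 g) !mulmxA.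
apply: bform_sym_or_alt_congr; apply/bform_sym_or_altP; split=> [i j|alt i].
  rewrite 2!mxE [D0 i j]mxE [Del i j]mxE eq_sym; case: eqP => [eij|]; last by rewrite mulr0.
  rewrite symPhi symb_sign; last first.
    by have := wPhi i j; congr wge; rewrite /nb; rewrite /e in eij; lia.
  by congr (_ * symb _ _); rewrite /nb; rewrite /e in eij; lia.
by rewrite mxE eqxx mxE altPhi // symb0.
Qed.

(** * From a Jordan-Hölder filtration to a weighted lattice *)

Lemma smx_lift n (P : 'M[k]_n) : P \in unitmx ->
  exists Q Q' : 'M[K]_n,
    [/\ Q *m Q' = 1%:M, wmx (fun=> 0) (fun=> 0) Q, wmx (fun=> 0) (fun=> 0) Q',
        smx (fun=> 0) (fun=> 0) Q = P & smx (fun=> 0) (fun=> 0) Q' = invmx P].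
Proof.
move=> uP; have /fin_all_exists[q qP] (ij : 'I_n * 'I_n) :
    exists x, wge 0 x /\ symb 0 x = P ij.1 ij.2.
  by have [x wx xE] := symb_surj (P ij.1 ij.2) (dvdz0 N); exists x.
pose Q : 'M[K]_n := \matrix_(i, j) q (i, j).
have wQ : wmx (fun=> 0) (fun=> 0) Q by move=> i j; rewrite mxE; case: (qP (i, j)).
have QE : smx (fun=> 0) (fun=> 0) Q = P.
  by apply/matrixP=> i j; rewrite !mxE; case: (qP (i, j)).
(* The symbol of the determinant of [Q] is that of [P], hence nonzero. *)
have uQ : Q \in unitmx.
  rewrite unitmxE unitfE; apply: contraTneq uP => Q0.
  by rewrite unitmxE unitfE -QE; case: (wmx_det wQ) => _ <-; rewrite Q0 symb0 negbK.
have w1 : wmx (fun=> 0) (fun=> 0) (Q *m invmx Q).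
  by rewrite mulmxV //; exact (wmx1 (fun=> 0)).
have wQ' : wmx (fun=> 0) (fun=> 0) (invmx Q).
  by apply: (wmx_cancel _ wQ _ w1); rewrite ?QE // => _; rewrite addr0.
exists Q, (invmx Q); split; rewrite ?mulmxV //.
rewrite -[LHS](mulKmx uP) -{2}QE -(smxM (fun=> addr0 0) wQ wQ') mulmxV //.
by rewrite [smx _ _ _](smx1 (fun=> 0)) mulmx1.
Qed.

End WeightedMatrices.

Theorem theoremA
  (K : fieldType) (R : {pred K}) (pi : K) (k : fieldType) (red : K -> k)
  (G : groupType) (n : nat) (rho : G -> 'M[K]_n) (sym : bool) :
  is_DVR_with_uniformizer R pi ->
  is_residue_map R pi red ->
  is_rep rho ->
  (exists B : 'M[K]_n, is_lattice_basis B /\ lattice_stable R rho B) ->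
  (exists A : 'M[K]_n,
     [/\ bform_nondegenerate A, bform_invariant rho A & bform_sym_or_alt sym A]) ->
  (sym -> (2 : k) != 0) ->
  (* for every G-stable lattice L and every Jordan-Holder filtration of L/piL,
     the resulting semisimplification V_k carries such a form *)
  forall (B : 'M[K]_n), is_lattice_basis B -> lattice_stable R rho B ->
  forall (P : 'M[k]_n) (blk : 'I_n -> nat),
    is_JH_filtration (reduced_rep red rho B) P blk ->
    exists A : 'M[k]_n,
      [/\ bform_nondegenerate A,
          bform_invariant (semisimplification (reduced_rep red rho B) P blk) A
        & bform_sym_or_alt sym A].
Proof.
move=> dvr resm [urho rhoM] _ [A [/bform_unitmx uA /bform_invariantP invA symA]] _.
move=> B uB stB P blk [uP triP simpleP].
pose N := (\max_i blk i).+1; have N_gt0 : (0 < N)%N by [].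
have blkN i : (blk i < N)%N by rewrite ltnS leq_bigmax.
have [Q [Q' [QQ' wQ wQ' QE Q'E]]] := smx_lift dvr resm N_gt0 uP.
pose L g := invmx B *m rho g *m B.
pose M g := Q' *m L g *m Q.
have z0 (j : 'I_n) : (0 : int) + 0 = 0 by rewrite addr0.
have wL g : wmx R pi N (fun=> 0) (fun=> 0) (L g).
  by move=> i j; apply/(wge_ring dvr N_gt0); apply: stB.
have LE g : smx pi red N (fun=> 0) (fun=> 0) (L g) = reduced_rep red rho B g.
  by apply/matrixP=> i j; rewrite !mxE addr0 (symb_ring red dvr N_gt0).
have wQL g := wmxM dvr N_gt0 z0 wQ' (wL g).
have wM0 g : wmx R pi N (fun=> 0) (fun=> 0) (M g) := wmxM dvr N_gt0 z0 (wQL g) wQ.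
have ME g i j : red (M g i j) = (invmx P *m reduced_rep red rho B g *m P) i j.
  rewrite -LE -Q'E -[in RHS]QE -(smxM dvr resm N_gt0 z0 wQ' (wL g)).
  by rewrite -(smxM dvr resm N_gt0 z0 (wQL g) wQ) [RHS]mxE addr0 (symb_ring red dvr N_gt0).
pose b i := (blk i)%:Z.
(* Where blk i <= blk j the required weight is at most 0. Elsewhere the entry reduces to 0, so it is
   divisible by pi, of weight N > blk i - blk j. *)
have wM g : wmx R pi N b (fun i => - b i) (M g).
  move=> i j; have wMij : wge R pi N 0 (M g i j) := wM0 g i j.
  have [le_ij|lt_ji] := leqP (blk i) (blk j).
    by apply: (wge_le dvr N_gt0 _ wMij); rewrite /b /=; lia.
  apply: (wge_red0 dvr resm); first by have := blkN i; rewrite /b /=; lia.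
    exact/(wge_ring dvr N_gt0).
  by rewrite ME triP.
(* Off the diagonal blocks the level is not divisible by N, since all labels are below N, so the
   symbol is 0. *)
have WE g : smx pi red N b (fun i => - b i) (M g) =
    semisimplification (reduced_rep red rho B) P blk g.
  apply/matrixP=> i j; rewrite mxE [RHS]mxE -ME.
  case: eqP => [eij|neij]; first by rewrite /b eij subrr (symb_ring red dvr N_gt0).
  by apply/eqP; apply: contra_notT neij => /(symb_label dvr N_gt0 (blkN i) (blkN j))->.
have [T [T' [TT' MTE]]] : exists T T', T *m T' = 1%:M /\ forall g, M g = T' *m rho g *m T.
  exists (B *m Q), (Q' *m invmx B); split; last by move=> g; rewrite /M /L !mulmxA.
  by rewrite mulmxA -(mulmxA B) QQ' mulmx1 mulmxV.
have rho1 : rho 1%g = 1%:M.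
  by rewrite -[LHS](mulKmx (urho 1%g)) -rhoM mulg1 mulVmx.
have MV g : exists h, M h *m M g = 1%:M.
  exists g^-1%g; rewrite !MTE !mulmxA -(mulmxA _ T T') TT' mulmx1.
  by rewrite -(mulmxA T') -rhoM mulVg rho1 mulmx1 (mulmx1C TT').
have [uT _] := mulmx1_unit TT'.
have [||g||D [uD invD symD]] := @wmx_form_reduction _ _ _ _ _ dvr resm N N_gt0
    G n sym blk M (T^T *m A *m T) blkN wM MV.
- move=> c blkc U Uc stU; apply: (simpleP c) => // g.
  by have := stU g; rewrite WE.
- by rewrite !unitmx_mul unitmx_tr uT uA.
- have trTT' : T'^T *m T^T = 1%:M by rewrite -trmx_mul TT' trmx1.
  rewrite MTE !trmx_mul !mulmxA -(mulmxA _ T'^T T^T) trTT' mulmx1.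
  by rewrite -(mulmxA _ T T') TT' mulmx1 -[in RHS](invA g) !mulmxA.
- exact: bform_sym_or_alt_congr.
exists D; split=> //; first exact/bform_unitmx.
by apply/bform_invariantP => g; rewrite -WE.
Qed.
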